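(* Let $C\subseteq\mathbb{R}^n$ be a convex set, let $\varphi:\mathbb{R}^n\to\mathbb{R}^m$ be a mapping and $\psi:\mathbb{R}^m\to\mathbb{R}\cup\{+\infty\}$ a proper function such that $(\varphi,\psi)$ is a convex-pair with respect to $C$. If $\psi$ is uniformly quasiconvex with modulus $\phi$ and $\varphi$ is uniformly regular on $C$ with modulus $\vartheta$, then the composite function $x\mapsto\psi(\varphi(x))$ is uniformly quasiconvex on $C$ with modulus $\phi\circ\vartheta$.
   Context: $\|\cdot\|$ is the Euclidean norm; $\operatorname{dom}\psi=\{x:\psi(x)<+\infty\}$; $\psi$ is proper if $\operatorname{dom}\psi\neq\emptyset$. A modulus is an increasing function $\phi:[0,+\infty)\to[0,+\infty]$ (i.e. $s\le t$ implies $\phi(s)\le\phi(t)$) that vanishes only at $0$; in compositions of moduli, $\phi(+\infty):=+\infty$. A proper function $\psi$ with convex domain is uniformly quasiconvex with modulus $\phi$ if for all $x,y\in\operatorname{dom}\psi$ and $\lambda\in[0,1]$, $$\psi(\lambda x+(1-\lambda)y)+\lambda(1-\lambda)\phi(\|x-y\|)\le\max\{\psi(x),\psi(y)\};$$ a function is uniformly quasiconvex on a convex subset $C$ of its domain with modulus $\phi$ if this inequality holds for all $x,y\in C$ and $\lambda\in[0,1]$. Convex-pair: with $C\subseteq\mathbb{R}^n$ convex and $\varphi(C)\subseteq\operatorname{dom}\psi$, the pair $(\varphi,\psi)$ is a convex-pair with respect to $C$ if $\psi(\varphi(\lambda x+(1-\lambda)y))\le\psi(\lambda\varphi(x)+(1-\lambda)\varphi(y))$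 for all $x,y\in C$ and $\lambda\in[0,1]$. Uniform regularity: $\varphi:\mathbb{R}^n\to\mathbb{R}^m$ is uniformly regular on $C$ with modulus $\vartheta$ if $\vartheta(\|x-y\|)\le\|\varphi(x)-\varphi(y)\|$ for all $x,y\in C$. *)

(* Defs.v *)
From mathcomp Require Import all_boot all_order all_algebra.
From mathcomp Require Import all_classical reals ereal convex.

Set Implicit Arguments.
Unset Strict Implicit.
Unset Printing Implicit Defensive.

Import Order.TTheory GRing.Theory Num.Theory.

Local Open Scope classical_set_scope.
Local Open Scope ring_scope.

(* The library norm on 'rV[R]_n is the max norm, hence this definition. *)
Definition enorm (R : realType) (n : nat) (x : 'rV[R]_n) : R :=
  Num.sqrt (\sum_(i < n) x 0 i ^+ 2).

Definition dom (R : realType) (T : Type) (psi : T -> \bar R) : set T :=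
  [set x | (psi x < +oo)%E].

Definition proper_fun (R : realType) (T : Type) (psi : T -> \bar R) : Prop :=
  dom psi !=set0.

(* A function [0, +oo) -> [0, +oo] is represented by a function on R, whose
   values at negative reals are irrelevant. *)
Definition is_modulus (R : realType) (phi : R -> \bar R) : Prop :=
  [/\ forall t, 0 <= t -> (0 <= phi t)%E,
      forall s t, 0 <= s -> s <= t -> (phi s <= phi t)%E
    & forall t, 0 <= t -> (phi t = 0%E <-> t = 0)].

(* The composition phi o theta with the convention phi(+oo) := +oo.  The value
   -oo is never taken by a modulus on [0, +oo). *)
Definition modulus_comp (R : realType) (phi theta : R -> \bar R) : R -> \bar R :=
  fun t => if theta t is r%:E then phi r else +oo%E.

(* The product below uses the convention 0 * (+oo) = 0. *)
Definition uniformly_quasiconvex_on (R : realType) (n : nat)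
    (C : set 'rV[R]_n) (phi : R -> \bar R) (psi : 'rV[R]_n -> \bar R) : Prop :=
  [/\ is_modulus phi, convex_set C, C `<=` dom psi
    & forall x y, C x -> C y -> forall l : R, 0 <= l <= 1 ->
      (psi (l *: x + (1 - l) *: y)%R
         + (l * (1 - l))%:E * phi (enorm (x - y)%R)
       <= maxe (psi x) (psi y))%E].

Definition uniformly_quasiconvex (R : realType) (n : nat)
    (phi : R -> \bar R) (psi : 'rV[R]_n -> \bar R) : Prop :=
  proper_fun psi /\ uniformly_quasiconvex_on (dom psi) phi psi.

Definition convex_pair (R : realType) (n m : nat) (C : set 'rV[R]_n)
    (f : 'rV[R]_n -> 'rV[R]_m) (psi : 'rV[R]_m -> \bar R) : Prop :=
  [/\ convex_set C, f @` C `<=` dom psi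
    & forall x y, C x -> C y -> forall l : R, 0 <= l <= 1 ->
      (psi (f (l *: x + (1 - l) *: y)%R)
       <= psi (l *: f x + (1 - l) *: f y)%R)%E].

Definition uniformly_regular_on (R : realType) (n m : nat) (C : set 'rV[R]_n)
    (theta : R -> \bar R) (f : 'rV[R]_n -> 'rV[R]_m) : Prop :=
  is_modulus theta /\
  forall x y, C x -> C y -> (theta (enorm (x - y)%R) <= (enorm (f x - f y)%R)%:E)%E.

(* Main.v *)
Require Import Defs.
From mathcomp Require Import all_boot all_order all_algebra.
From mathcomp Require Import all_classical reals ereal convex.

Import Order.TTheory GRing.Theory Num.Theory.

Local Open Scope classical_set_scope.
Local Open Scope ring_scope.

(** The convex-pair inequality bounds [psi] at the image of a convex combination by [psi] at the
    same combination of [f x] and [f y]. There quasiconvexity of [psi] leaves a gap governed by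
    [phi] at the distance of [f x] and [f y], and by regularity and monotonicity of [phi] this is at
    least [phi] of [theta] at the distance of [x] and [y] ([modulus_comp_le]). *)

Lemma enorm_ge0 (R : realType) (n : nat) (x : 'rV[R]_n) : 0 <= enorm x.
Proof. exact: sqrtr_ge0. Qed.

(** Where [theta] is finite, the properties chain through [phi]; where it is [+oo], the composition
    is the top element, which preserves order and is nonzero. *)
Lemma modulus_comp_is_modulus (R : realType) (phi theta : R -> \bar R) :
  is_modulus phi -> is_modulus theta -> is_modulus (modulus_comp phi theta).
Proof.
move=> [phi_ge0 phi_le phi_eq0] [theta_ge0 theta_le theta_eq0].
split; rewrite /modulus_comp.
- move=> t t0; have := theta_ge0 t t0.
  by case: (theta t) => [r||] //; rewrite lee_fin => /phi_ge0.
- move=> s t s0 st; have := theta_ge0 s s0; have := theta_le s t s0 st.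
  case: (theta s) => [r||]; case: (theta t) => [r'||] //; rewrite ?leey //.
  by rewrite !lee_fin => rr' r0; exact: phi_le.
- move=> t t0; have := theta_ge0 t t0; have := theta_eq0 t t0.
  case: (theta t) => [r||] // [theta_t0 t_theta0].
  rewrite lee_fin => r0; split=> [/(phi_eq0 r r0) r_eq0|/t_theta0 [r_eq0]].
    by apply: theta_t0; rewrite r_eq0.
  exact/phi_eq0.
Qed.

(** The real bound [t] rules out [theta s = +oo], so only monotonicity of [phi] is at stake. *)
Lemma modulus_comp_le (R : realType) (phi theta : R -> \bar R) (s t : R) :
  is_modulus phi -> is_modulus theta -> 0 <= s -> (theta s <= t%:E)%E ->
  (modulus_comp phi theta s <= phi t)%E.
Proof.
move=> [_ phi_le _] [theta_ge0 _ _] s0; have := theta_ge0 s s0.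
rewrite /modulus_comp; case: (theta s) => [r||] //.
by rewrite !lee_fin; exact: phi_le.
Qed.

Theorem theorem3p12 (R : realType) (n m : nat) (C : set 'rV[R]_n)
    (f : 'rV[R]_n -> 'rV[R]_m) (psi : 'rV[R]_m -> \bar R)
    (phi theta : R -> \bar R) :
  convex_set C ->
  (forall z, psi z <> -oo%E) ->
  proper_fun psi ->
  convex_pair C f psi ->
  uniformly_quasiconvex phi psi ->
  uniformly_regular_on C theta f ->
  uniformly_quasiconvex_on C (modulus_comp phi theta) (fun x => psi (f x)).
Proof.
move=> Cconv _ _ [_ fC fpsi] [_ [phi_mod _ _ psi_qc]] [theta_mod f_reg].
have fdom x : C x -> dom psi (f x) by move=> Cx; apply: fC; exists x.
split=> //; first exact: modulus_comp_is_modulus.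
move=> x y Cx Cy l l01; have /andP[l0 l1] := l01.
(* With quasiconvexity taken at [f x] and [f y], the two left-hand sides are compared term by
   term. *)
apply: le_trans (psi_qc _ _ (fdom x Cx) (fdom y Cy) l l01).
apply: leeD; first exact: fpsi.
apply: lee_wpmul2l; first by rewrite lee_fin mulr_ge0 // subr_ge0.
by apply: modulus_comp_le => //; [exact: enorm_ge0|exact: f_reg].
Qed.
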